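(* For every group $G$, the positive theory $T_G$ of linear orders with an action of $G$ by automorphisms is $\mathsf{NIP}$ (in the sense of positive logic).
   Context: $T_G$ is the theory, in the language $L_G=\{<\}\cup\{g\cdot-:g\in G\}$ (each $g\cdot-$ a unary function symbol), saying that $<$ is a (strict) linear order and that the functions $g\cdot-$ define an action of $G$ by order automorphisms. It is regarded as a positive theory: it is axiomatised by h-inductive sentences, and modulo it $\neg(x<y)$ is equivalent to $(x=y)\vee(y<x)$ and $\neg(x=y)$ to $(x<y)\vee(y<x)$. It has the Joint Continuation Property. Positive logic: a positive formula is one built from atomic formulas (including equalities) using $\wedge,\vee,\top,\bot,\exists$. An h-inductive sentence is $\forall x\,(\varphi(x)\to\psi(x))$ with $\varphi,\psi$ positive; a positive theory is a consistent set of h-inductive sentences. A positive theory has the Joint Continuation Property if any two of its models admit homomorphisms into a common model. For a positive theory $T$ with this property, a positive formula $\varphi(x;y)$ has $\mathsf{IP}$ if there are a positive $\psi(x;y)$ with $T\models\forall x,y\,\neg(\varphi(x;y)\wedge\psi(x;y))$, a model $A\models T$, and tuples $(a_i)_{i\in\omega}$, $(b_W)_{W\subseteq\omega}$ from $A$ such that $A\models\varphi(a_i;b_W)$ whenever $i\in W$ and $A\models\psi(a_i;b_W)$ whenever $i\notin W$. Otherwise $\varphi$ is $\mathsf{NIP}$. $T$ is $\mathsf{NIP}$ if every positive formula is. *)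

(* Defs.v *)
From HB Require Import structures.
From mathcomp Require Import all_boot.
From mathcomp Require Import boolp classical_sets.

Set Implicit Arguments.
Unset Strict Implicit.
Unset Printing Implicit Defensive.

(* An n-tuple of elements of a type A is a function 'I_n -> A. *)

Record language := Language {
  fsym : Type;
  farity : fsym -> nat;
  rsym : Type;
  rarity : rsym -> nat }.

Record structure (L : language) := Structure {
  carrier :> Type;
  carrier_inh : inhabited carrier;
  fint : forall f : fsym L, ('I_(farity f) -> carrier) -> carrier;
  rint : forall r : rsym L, ('I_(rarity r) -> carrier) -> Prop }.

Arguments fint {L} _ f _.
Arguments rint {L} _ r _.

Definition hom (L : language) (A B : structure L) (h : A -> B) : Prop :=
  (forall (f : fsym L) (a : 'I_(farity f) -> A),
      h (fint A f a) = fint B f (h \o a)) /\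
  (forall (r : rsym L) (a : 'I_(rarity r) -> A),
      rint A r a -> rint B r (h \o a)).

Inductive term (L : language) (V : Type) : Type :=
| Var of V
| App (f : fsym L) of ('I_(farity f) -> term L V).

Arguments Var {L V} _.
Arguments App {L V} f _.

(* [pform L V] is the type of positive formulas with free variables in V.  In
   [PEx p] the quantified variable is [None : option V]. *)
Inductive pform (L : language) (V : Type) : Type :=
| PTop
| PBot
| PEq of term L V & term L V
| PRel (r : rsym L) of ('I_(rarity r) -> term L V)
| PAnd of pform L V & pform L V
| POr of pform L V & pform L V
| PEx of pform L (option V).

Arguments PTop {L V}.
Arguments PBot {L V}.
Arguments PRel {L V} r _.
Arguments PEx {L V} _.

Section Semantics.
Variables (L : language) (A : structure L).

Fixpoint eval (V : Type) (e : V -> A) (t : term L V) : A :=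
  match t with
  | Var v => e v
  | App f ts => fint A f (fun i => eval e (ts i))
  end.

Fixpoint sat (V : Type) (p : pform L V) : (V -> A) -> Prop :=
  match p with
  | PTop => fun=> True
  | PBot => fun=> False
  | PEq t u => fun e => eval e t = eval e u
  | PRel r ts => fun e => rint A r (fun i => eval e (ts i))
  | PAnd p q => fun e => sat p e /\ sat q e
  | POr p q => fun e => sat p e \/ sat q e
  | PEx p => fun e => exists a : A, sat p (fun v => oapp e a v)
  end.

End Semantics.

(* [HInd p q] is the h-inductive sentence forall x_0 .. x_(k-1), p -> q. *)
Record hsentence (L : language) := HInd {
  hvars : nat;
  hyp : pform L 'I_hvars;
  concl : pform L 'I_hvars }.

Definition hholds (L : language) (A : structure L) (s : hsentence L) : Prop :=
  forall e : 'I_(hvars s) -> A, sat (hyp s) e -> sat (concl s) e.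

Definition is_model (L : language) (T : set (hsentence L)) (A : structure L) :
  Prop := forall s : hsentence L, T s -> hholds A s.

Record positive_theory (L : language) := PositiveTheory {
  axioms :> set (hsentence L);
  consistent : exists A : structure L, is_model axioms A }.

Definition JCP (L : language) (T : positive_theory L) : Prop :=
  forall A B : structure L, is_model T A -> is_model T B ->
  exists C : structure L, is_model T C /\
    (exists h : A -> C, hom h) /\ (exists h : B -> C, hom h).

Record jcp_theory (L : language) := JCPTheory {
  jcp_axioms :> positive_theory L;
  jcpP : JCP jcp_axioms }.

(* A formula phi(x; y), with x an m-tuple and y an n-tuple of variables, is an
   element of [pform L ('I_m + 'I_n)]. *)
Definition sat2 (L : language) (A : structure L) (m n : nat)
    (p : pform L ('I_m + 'I_n)) (a : 'I_m -> A) (b : 'I_n -> A) : Prop :=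
  sat p (fun v => match v with inl i => a i | inr j => b j end).

Definition IP (L : language) (T : jcp_theory L) (m n : nat)
    (phi : pform L ('I_m + 'I_n)) : Prop :=
  exists psi : pform L ('I_m + 'I_n),
    (forall A : structure L, is_model T A ->
       forall (a : 'I_m -> A) (b : 'I_n -> A),
         ~ (sat2 phi a b /\ sat2 psi a b)) /\
    exists A : structure L, is_model T A /\
      exists (a : nat -> 'I_m -> A) (b : set nat -> 'I_n -> A),
        forall (i : nat) (W : set nat),
          (W i -> sat2 phi (a i) (b W)) /\ (~ W i -> sat2 psi (a i) (b W)).

Definition NIP (L : language) (T : jcp_theory L) : Prop :=
  forall (m n : nat) (phi : pform L ('I_m + 'I_n)), ~ IP T phi.

Definition LG (G : groupType) : language :=
  @Language G (fun=> 1) unit (fun=> 2).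

Section TG.
Variable G : groupType.

Definition pair2 (X : Type) (x y : X) (i : 'I_2) : X :=
  if i == ord0 then x else y.

Definition tact (V : Type) (g : G) (t : term (LG G) V) : term (LG G) V :=
  @App (LG G) V g (fun=> t).

Definition plt (V : Type) (t u : term (LG G) V) : pform (LG G) V :=
  @PRel (LG G) V tt (pair2 t u).

Definition tvar (k i : nat) : term (LG G) 'I_k.+1 := Var (inord i).

Local Notation x := (tvar _ 0).
Local Notation y := (tvar _ 1).
Local Notation z := (tvar _ 2).

Inductive TG_axioms : set (hsentence (LG G)) :=
| TG_irr : TG_axioms (@HInd _ 1 (plt x x) PBot)
| TG_trans : TG_axioms (@HInd _ 3 (PAnd (plt x y) (plt y z)) (plt x z))
| TG_total : TG_axioms (@HInd _ 2 PTop (POr (plt x y) (POr (PEq x y) (plt y x))))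
| TG_act1 : TG_axioms (@HInd _ 1 PTop (PEq (tact 1%g x) x))
| TG_actM (g h : G) :
    TG_axioms (@HInd _ 1 PTop (PEq (tact (g * h)%g x) (tact g (tact h x))))
| TG_mono (g : G) :
    TG_axioms (@HInd _ 2 (plt x y) (plt (tact g x) (tact g y))).

Definition olt (A : structure (LG G)) (a b : A) : Prop :=
  rint A (tt : rsym (LG G)) (pair2 a b).

Definition act (A : structure (LG G)) (g : G) (a : A) : A :=
  fint A (g : fsym (LG G)) (fun=> a).

Lemma pair2_comp (X Y : Type) (f : X -> Y) (a b : X) :
  (fun i => f (pair2 a b i)) = pair2 (f a) (f b).
Proof. by apply/funext => i; rewrite /pair2; case: ifP. Qed.

Lemma pair2_eta (X : Type) (v : 'I_2 -> X) : v = pair2 (v ord0) (v ord_max).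
Proof.
apply/funext => i; rewrite /pair2; case: eqP => [->//|ne].
congr v; apply/val_inj; case: i ne => [[|[|i]]] //= Hi ne.
by case: ne; apply/val_inj.
Qed.

Lemma sat_plt (A : structure (LG G)) (V : Type) (e : V -> A)
  (t u : term (LG G) V) : sat (plt t u) e <-> olt (eval e t) (eval e u).
Proof. by rewrite /= /olt (pair2_comp (eval e)). Qed.

Lemma TG_modelP (A : structure (LG G)) :
  is_model TG_axioms A <->
  [/\ forall a : A, ~ olt a a,
      forall a b c : A, olt a b -> olt b c -> olt a c &
      forall a b : A, olt a b \/ a = b \/ olt b a] /\
  [/\ forall a : A, act 1%g a = a,
      forall (g h : G) (a : A), act (g * h)%g a = act g (act h a) &
      forall (g : G) (a b : A), olt a b -> olt (act g a) (act g b)].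
Proof.
split=> [mA|[[irr trans total] [act1 actM mono]] s].
- have i0 k : (inord 0 : 'I_k.+1) = 0 :> nat by rewrite inordK.
  have i1 k : (inord 1 : 'I_k.+2) = 1 :> nat by rewrite inordK.
  have i2 k : (inord 2 : 'I_k.+3) = 2 :> nat by rewrite inordK.
  pose env k (a b c : A) (i : 'I_k) : A := nth c [:: a; b] i.
  split; split.
  + move=> a; move: (mA _ TG_irr (env _ a a a)).
    by rewrite /= => H aa; apply: H; rewrite pair2_comp /= /env i0.
  + move=> a b c ab bc; move: (mA _ TG_trans (env _ a b c)).
    rewrite /= !pair2_comp /= /env i0 i1 i2; exact.
  + move=> a b; move: (mA _ TG_total (env _ a b b) I).
    by rewrite /= !pair2_comp /= /env i0 i1.
  + by move=> a; move: (mA _ TG_act1 (env _ a a a) I); rewrite /= /env i0.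
  + by move=> g h a; move: (mA _ (TG_actM g h) (env _ a a a) I);
      rewrite /= /env i0.
  + move=> g a b ab; move: (mA _ (TG_mono g) (env _ a b b)).
    rewrite /= !pair2_comp /= /env i0 i1; exact.
- case=> [e|e|e _|e _|g h e _|g e] /=; rewrite ?pair2_comp //=.
  + exact: irr.
  + by case=> xy yz; apply: trans xy yz.
  + exact: total.
  + exact: act1.
  + exact: actM.
  + exact: mono.
Qed.

Lemma TG_consistent : exists A : structure (LG G), is_model TG_axioms A.
Proof.
exists (@Structure (LG G) unit (inhabits tt) (fun _ _ => tt) (fun _ _ => False)).
apply/TG_modelP; split; split => //; last by case.
- by move=> a; rewrite /olt.
- by case=> -[]; right; left.
Qed.

Definition TG_positive : positive_theory (LG G) :=
  PositiveTheory TG_consistent.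

Definition osum (A B : structure (LG G)) : structure (LG G) :=
  @Structure (LG G) (A + B)
    (let: inhabits a := carrier_inh A in inhabits (inl a))
    (fun g v => match v ord0 with
                | inl a => inl (act g a)
                | inr b => inr (act g b)
                end)
    (fun _ v => match v ord0, v ord_max with
                | inl a, inl a' => olt a a'
                | inl _, inr _ => True
                | inr _, inl _ => False
                | inr b, inr b' => olt b b'
                end).

Lemma TG_JCP : JCP TG_positive.
Proof.
move=> A B /TG_modelP [[Ai At Al] [A1 AM Am]] /TG_modelP [[Bi Bt Bl] [B1 BM Bm]].
exists (osum A B); split; last split.
- apply/TG_modelP; split; split; rewrite /olt /act /pair2 /=.
  + by case=> [a|b]; [exact: Ai|exact: Bi].
  + by case=> [a|a] [b|b] [c|c] //; [exact: At|exact: Bt].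
  + case=> [a|a] [b|b]; try by [left|right; right].
    * by case: (Al a b) => [|[->|]]; [left|right; left|right; right].
    * by case: (Bl a b) => [|[->|]]; [left|right; left|right; right].
  + by case=> [a|b]; rewrite ?A1 ?B1.
  + by move=> g h [a|b]; rewrite ?AM ?BM.
  + by move=> g [a|a] [b|b] //; [exact: Am|exact: Bm].
- exists inl; split=> [g a|r a] /=.
  + congr inl; congr (fint A g _); apply/funext => i.
    by congr a; apply/val_inj; case: i => [[]].
  + by case: r a => a; rewrite {1}(pair2_eta a).
- exists inr; split=> [g a|r a] /=.
  + congr inr; congr (fint B g _); apply/funext => i.
    by congr a; apply/val_inj; case: i => [[]].
  + by case: r a => a; rewrite {1}(pair2_eta a).
Qed.

Definition T_G : jcp_theory (LG G) := JCPTheory TG_JCP.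

End TG.

(* Main.v *)
Require Import Defs.
From mathcomp Require Import all_boot.
From mathcomp Require Import boolp classical_sets filter.

(** Two facts make [T_G] NIP.

    The first is a form of amalgamation.  A structure generated by a tuple is
    the union of the [G]-orbits of its coordinates, and its isomorphism type is
    the list of the truth values of the atoms [x_v < g x_w]
    ([same_type]).  Two models containing tuples of the same type can be
    amalgamated over the generated substructures: in each cut of the common
    part, put the points of the first model before those of the second one.
    The group permutes the cuts, so this order is invariant
    ([amalgamation]).  As positive formulas are preserved by homomorphisms, two
    incompatible positive formulas cannot hold at tuples of the same type
    ([same_type_consistent]).  It is thus enough to extract from an [IP] pattern
    two pairs [(alpha, beta)] and [(alpha', beta)] of the same type with
    [phi (alpha, beta)] and [psi (alpha', beta)].

    The second is that a monotone sequence crosses a given cut at most once.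
    Choose a subsequence [a_(f 0), a_(f 1), ...] of the pattern all of whose
    coordinates are monotone, and compare it with [b_W] for
    [W = {f 0, f 2, f 4, ...}].  Each of the atoms [x_k < g y_l] and
    [y_l < g x_k] says on which side of the single point [g b_l] or
    [g^-1 b_l] the entry [x_k] lies, hence is eventually constant in
    [n] at [(a_(f n), b_W)]; so it does not tell [a_(f (2n))] from
    [a_(f (2n+1))] for [n] large, whereas [phi] holds at the former and
    [psi] at the latter.  The atoms in [y] alone are evaluated at the same tuple
    [b_W].  The atoms [x_k < g x_l] can also be made eventually constant, but
    only finitely many at a time, by shrinking the subsequence
    ([stabilizing_subsequence]).

    Since [G] may be infinite, the finite approximations to equality of types
    are glued in an ultrapower: the index set consists of the pairs [(s, n)]
    with [s] a finite set of atoms in [x], and the ultrafilter contains every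
    set which, for all large [s] and then all large [n], contains
    [(s, n)] ([tail_filter]).  Positive formulas pass from almost all coordinates
    to the ultrapower ([sat_ultra]).

    Both the amalgam and the ultrapower are quotients of a total preorder on
    which [G] acts ([quot_model]). *)

Set Implicit Arguments.
Unset Strict Implicit.
Unset Printing Implicit Defensive.

(** * Positive formulas and homomorphisms *)

Lemma eval_hom (L : language) (A B : structure L) (h : A -> B) :
  hom h -> forall (V : Type) (e : V -> A) (t : term L V),
  eval (h \o e) t = h (eval e t).
Proof.
move=> [hf _] V e; elim=> [//|f ts IH] /=.
by rewrite hf; congr (fint B f _); apply/funext => i; rewrite IH.
Qed.

Lemma sat_hom (L : language) (A B : structure L) (h : A -> B) :
  hom h -> forall (V : Type) (p : pform L V) (e : V -> A),
  sat p e -> sat p (h \o e).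
Proof.
move=> hh V p; elim: p => //=
  [{}V t u|{}V r ts|{}V p IHp q IHq|{}V p IHp q IHq|{}V p IH] e.
- by rewrite !eval_hom // => ->.
- have -> : (fun i => eval (h \o e) (ts i)) = h \o (fun i => eval e (ts i)).
    by apply/funext => i; rewrite eval_hom.
  by case: hh => _; apply.
- by case=> /IHp ? /IHq.
- by case=> [/IHp|/IHq]; [left|right].
- case=> a /IH pa; exists (h a).
  congr (sat p _): pa; by apply/funext; case.
Qed.

Lemma sat2E (L : language) (A : structure L) (m n : nat)
  (p : pform L ('I_m + 'I_n)) (e : 'I_m + 'I_n -> A) :
  sat2 p (e \o inl) (e \o inr) <-> sat p e.
Proof.
rewrite /sat2; have -> // : (fun v => match v with
  inl i => (e \o inl) i | inr j => (e \o inr) j end) = e.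
by apply/funext; case.
Qed.

(** * Models of [T_G] *)

(** In a linear order the negation of [b < a] is [a <= b]. *)
Definition ole (G : groupType) (A : structure (LG G)) (a b : A) : Prop :=
  ~ olt b a.

Section Order.
Context (G : groupType) (A : structure (LG G)) (mA : is_model (T_G G) A).
Implicit Types a b c : A.

Lemma ole_refl a : ole a a.
Proof. by move/TG_modelP: mA => [[irr _ _] _]; exact: irr. Qed.

Lemma ole_anti a b : ole a b -> ole b a -> a = b.
Proof.
by move/TG_modelP: mA => [[_ _ tot] _] ab ba; case: (tot a b) => [|[]].
Qed.

Lemma ole_total a b : ole a b \/ ole b a.
Proof.
move/TG_modelP: mA => [[irr tr _] _]; case: (pselect (olt b a)); last by left.
by move=> ba; right => ab; apply: (irr a); apply: tr ab ba.
Qed.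

Lemma ole_trans a b c : ole a b -> ole b c -> ole a c.
Proof.
move/TG_modelP: mA => [[irr tr tot] _] ab bc ca.
case: (tot a b) => [ab'|[eab|//]]; first by apply: bc; apply: tr ca ab'.
by apply: bc; rewrite -eab.
Qed.

Lemma act1m a : act 1%g a = a.
Proof. by move/TG_modelP: mA => [_ [a1 _ _]]. Qed.

Lemma actMm (g h : G) a : act (g * h)%g a = act g (act h a).
Proof. by move/TG_modelP: mA => [_ [_ aM _]]. Qed.

Lemma actKm (g : G) : cancel (@act G A g) (act g^-1%g).
Proof. by move=> a; rewrite -actMm mulVg act1m. Qed.

Lemma actVKm (g : G) : cancel (@act G A g^-1%g) (act g).
Proof. by move=> a; rewrite -actMm mulgV act1m. Qed.

Lemma olt_act (g : G) a b : olt (act g a) (act g b) <-> olt a b.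
Proof.
have mono h x y : olt x y -> olt (@act G A h x) (act h y).
  by move/TG_modelP: mA => [_ [_ _]]; apply.
by split=> [/(mono g^-1%g)|]; [rewrite !actKm|exact: mono].
Qed.

Lemma olt_actl (g : G) a b : olt (act g a) b <-> olt a (act g^-1%g b).
Proof. by rewrite -{1}(actVKm g b) olt_act. Qed.

Lemma olt_actr (g : G) a b : olt a (act g b) <-> olt (act g^-1%g a) b.
Proof. by rewrite olt_actl invgK. Qed.

Lemma ole_act (g : G) a b : ole (act g a) (act g b) <-> ole a b.
Proof. by rewrite /ole olt_act. Qed.

End Order.

(** * Quotients of preorders with a group action *)

(** Only the order is taken up to equivalence: the action laws [pact1] and
    [pactM] hold on the nose in the two preorders used below. *)
Record preorder_action (G : groupType) (X : Type) := PreorderAction {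
  ple : X -> X -> Prop;
  pact : G -> X -> X;
  ple_total : forall x y, ple x y \/ ple y x;
  ple_trans : forall x y z, ple x y -> ple y z -> ple x z;
  pact1 : forall x, pact 1%g x = x;
  pactM : forall g h x, pact (g * h)%g x = pact g (pact h x);
  ple_pact : forall g x y, ple x y -> ple (pact g x) (pact g y) }.

Section Quotient.
Local Open Scope classical_set_scope.
Context (G : groupType) (X : Type) (x0 : X) (P : preorder_action G X).

Definition pclass (x : X) : set X := [set y | ple P x y /\ ple P y x].

(** The elements are the equivalence classes themselves, as sets, so that
    equivalent points have equal images. *)
Definition quot_carrier : Type := {c : set X | exists x, c = pclass x}.

Definition quot_proj (x : X) : quot_carrier :=
  exist _ (pclass x) (ex_intro _ x erefl).

Definition quot_repr (c : quot_carrier) : X := sval (cid (svalP c)).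

Definition quot : structure (LG G) :=
  @Structure (LG G) quot_carrier (inhabits (quot_proj x0))
    (fun g v => quot_proj (pact P g (quot_repr (v ord0))))
    (fun _ v => ~ ple P (quot_repr (v ord_max)) (quot_repr (v ord0))).

Definition to_quot (x : X) : quot := quot_proj x.

Lemma ple_refl x : ple P x x.
Proof. by case: (ple_total P x x). Qed.

Lemma to_quot_eq x y : ple P x y -> ple P y x -> to_quot x = to_quot y.
Proof.
move=> xy yx; apply: eq_exist; apply/seteqP; split=> z /= [xz zx]; split.
- exact: ple_trans yx xz.
- exact: ple_trans zx xy.
- exact: ple_trans xy xz.
- exact: ple_trans zx yx.
Qed.

Lemma to_quotK c : to_quot (quot_repr c) = c.
Proof.
rewrite /quot_repr; case: cid => x /= cx.
by case: c cx => c p /= cx; apply: eq_exist.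
Qed.

Lemma quot_reprP x :
  ple P x (quot_repr (to_quot x)) /\ ple P (quot_repr (to_quot x)) x.
Proof.
rewrite /quot_repr; case: cid => y /= xy.
suff: pclass x y by [].
by rewrite xy /pclass /=; split; exact: ple_refl.
Qed.

Lemma olt_quot x y : olt (to_quot x) (to_quot y) <-> ~ ple P y x.
Proof.
have [xx' x'x] := quot_reprP x; have [yy' y'y] := quot_reprP y.
rewrite /olt /=; split=> H yx; apply: H.
- exact: ple_trans y'y (ple_trans yx xx').
- exact: ple_trans yy' (ple_trans yx x'x).
Qed.

Lemma act_quot g x : act g (to_quot x) = to_quot (pact P g x).
Proof.
have [xx' x'x] := quot_reprP x.
by apply: to_quot_eq; apply: ple_pact.
Qed.

Lemma quot_model : is_model (T_G G) quot.
Proof.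
apply/TG_modelP; split; split.
- by move=> a; rewrite -(to_quotK a) olt_quot => /(_ (ple_refl _)).
- move=> a b c; rewrite -(to_quotK a) -(to_quotK b) -(to_quotK c) !olt_quot.
  move=> ba cb ca; case: (ple_total P (quot_repr a) (quot_repr b)) => // ab.
  by apply: cb; apply: ple_trans ca ab.
- move=> a b; rewrite -(to_quotK a) -(to_quotK b) !olt_quot.
  case: (pselect (ple P (quot_repr a) (quot_repr b))) => ab; last by right; right.
  case: (pselect (ple P (quot_repr b) (quot_repr a))) => ba; last by left.
  by right; left; exact: to_quot_eq.
- by move=> a; rewrite -(to_quotK a) act_quot pact1.
- by move=> g h a; rewrite -(to_quotK a) !act_quot pactM.
- move=> g a b; rewrite -(to_quotK a) -(to_quotK b) !act_quot !olt_quot.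
  by move=> ba /(@ple_pact _ _ P g^-1%g); rewrite -!pactM mulVg !pact1.
Qed.

End Quotient.

(** * Amalgamation over a common substructure *)

Section Amalgam.
Context (G : groupType) (A B : structure (LG G)).
Context (mA : is_model (T_G G) A) (mB : is_model (T_G G) B).
Context (V : Type) (p : V -> A) (q : V -> B).

(** Equality and the reverse inequality need no clause of their own: [p v > g (p w)]
    amounts to [p w < g^-1 (p v)], and [=] is the absence of both
    inequalities. *)
Definition same_type : Prop := forall (g : G) (v w : V),
  olt (p v) (act g (p w)) <-> olt (q v) (act g (q w)).

(** The points [g (p v)] and [g (q v)] are to be identified; [b] lying below this
    common point and [a] above it forces [b <= a]. *)
Definition separates (v : V) (g : G) (a : A) (b : B) : Prop :=
  ole b (act g (q v)) /\ ole (act g (p v)) a.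

(** A point of [B] lies below a point of [A] only if this is forced; otherwise
    the point of [A] comes first.  The equalities in the last clause
    are the case where [a] and [b] become the same common point. *)
Definition amalgam_le (x y : A + B) : Prop :=
  match x, y with
  | inl a, inl a' => ole a a'
  | inr b, inr b' => ole b b'
  | inr b, inl a => exists v g, separates v g a b
  | inl a, inr b => forall v g, separates v g a b ->
                      a = act g (p v) /\ b = act g (q v)
  end.

Definition amalgam_act (g : G) (x : A + B) : A + B :=
  match x with inl a => inl (act g a) | inr b => inr (act g b) end.

Lemma separates_act g h v a b :
  separates v (g * h)%g (act g a) (act g b) <-> separates v h a b.
Proof. by rewrite /separates !actMm // !ole_act. Qed.

Lemma amalgam_total x y : amalgam_le x y \/ amalgam_le y x.
Proof.
have mixed a b : amalgam_le (inl a) (inr b) \/ amalgam_le (inr b) (inl a).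
  case: (pselect (amalgam_le (inr b) (inl a))); first by right.
  by move=> nba; left => v g vg; case: nba; exists v, g.
case: x y => [a|b] [a'|b'] //=; try exact: ole_total; first exact: mixed.
by apply/or_comm; exact: mixed.
Qed.

Lemma amalgam_trans x y z : amalgam_le x y -> amalgam_le y z -> amalgam_le x z.
Proof.
case: x y z => [a|b] [a'|b'] [a''|b''] /=.
- exact: ole_trans.
- move=> aa' a'b v g [bq pa].
  have [a'p eb] := a'b v g (conj bq (ole_trans mA pa aa')).
  by split=> //; apply: (ole_anti mA) pa; rewrite -a'p.
- move=> ab [v [g [bq pa]]]; case: (ole_total mA a (act g (p v))) => [ap|pa'].
    exact: ole_trans ap pa.
  by have [-> _] := ab v g (conj bq pa').
- move=> ab bb' v g [b'q pa].
  have [ea eb] := ab v g (conj (ole_trans mB bb' b'q) pa).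
  by split=> //; apply: (ole_anti mB) b'q _; rewrite -eb.
- move=> [v [g [bq pa]]] aa'; exists v, g; split=> //; exact: ole_trans pa aa'.
- move=> [v [g [bq pa]]] ab; case: (ole_total mB (act g (q v)) b'') => [qb|bq'].
    exact: ole_trans bq qb.
  by have [_ ->] := ab v g (conj bq' pa).
- move=> bb' [v [g [bq pa]]]; exists v, g; split=> //; exact: ole_trans bb' bq.
- exact: ole_trans.
Qed.

Lemma amalgam_act_mono g x y :
  amalgam_le x y -> amalgam_le (amalgam_act g x) (amalgam_act g y).
Proof.
case: x y => [a|b] [a'|b'] /=; rewrite ?ole_act //.
- move=> ab v h; rewrite -{1}(mulVKg g h) separates_act => /ab [-> ->].
  by rewrite -!actMm // mulVKg.
- by move=> [v [h s]]; exists v, (g * h)%g; rewrite separates_act.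
Qed.

Lemma amalgam_act1 x : amalgam_act 1%g x = x.
Proof. by case: x => x /=; rewrite act1m. Qed.

Lemma amalgam_actM g h x :
  amalgam_act (g * h)%g x = amalgam_act g (amalgam_act h x).
Proof. by case: x => x /=; rewrite actMm. Qed.

Definition amalgam : preorder_action G (A + B) :=
  PreorderAction amalgam_total amalgam_trans amalgam_act1 amalgam_actM
    amalgam_act_mono.

Lemma same_type_ole g h v w : same_type ->
  ole (act g (p v)) (act h (p w)) <-> ole (act g (q v)) (act h (q w)).
Proof.
by move=> pq; rewrite /ole !(olt_actl mA) !(olt_actl mB) -!actMm // pq.
Qed.

(** Equality of types makes [p v] and [q v] equivalent: a common point
    [g (p w)], [g (q w)] with [q v <= g (q w)] and [g (p w) <= p v] lies on the
    same side of [p v] in [A] as of [q v] in [B], so it coincides with them. *)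
Lemma amalgamation : same_type ->
  exists C : structure (LG G), is_model (T_G G) C /\
    exists (h : A -> C) (k : B -> C), [/\ hom h, hom k & h \o p = k \o q].
Proof.
move=> pq; have [a0] := carrier_inh A.
pose C := quot (inl a0) amalgam; exists C; split; first exact: quot_model.
exists (fun a => to_quot (inl a0) amalgam (inl a)).
exists (fun b => to_quot (inl a0) amalgam (inr b)); split.
- split=> [g|[]] a.
    rewrite [LHS](_ : _ = to_quot (inl a0) amalgam (pact amalgam g (inl (a ord0)))).
      by rewrite -act_quot; congr (fint C g _); apply/funext => i /=; rewrite ord1.
    by congr (to_quot _ _ (inl _)); congr (fint A g _); apply/funext => i; rewrite ord1.
  rewrite (pair2_eta a) => aa.
  rewrite [X in rint C _ X]pair2_comp; apply/olt_quot => /=.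
  by move/(_ aa).
- split=> [g|[]] b.
    rewrite [LHS](_ : _ = to_quot (inl a0) amalgam (pact amalgam g (inr (b ord0)))).
      by rewrite -act_quot; congr (fint C g _); apply/funext => i /=; rewrite ord1.
    by congr (to_quot _ _ (inr _)); congr (fint B g _); apply/funext => i; rewrite ord1.
  rewrite (pair2_eta b) => bb.
  rewrite [X in rint C _ X]pair2_comp; apply/olt_quot => /=.
  by move/(_ bb).
- apply/funext => v /=; apply: to_quot_eq => /=.
    move=> w g [qw pw]; have := same_type_ole 1%g g v w pq.
    have := same_type_ole g 1%g w v pq; rewrite !act1m //.
    move=> [/(_ pw) qw' _] [_ /(_ qw) pw'].
    by split; [exact: ole_anti pw' pw|exact: ole_anti qw qw'].
  by exists v, 1%g; rewrite /separates !act1m //; split; exact: ole_refl.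
Qed.

End Amalgam.

(** In the amalgam the two tuples become one, and positive formulas persist
    there. *)
Lemma same_type_consistent (G : groupType) (A B : structure (LG G)) (V : Type)
  (p : V -> A) (q : V -> B) (phi psi : pform (LG G) V) :
  is_model (T_G G) A -> is_model (T_G G) B -> same_type p q ->
  sat phi p -> sat psi q ->
  exists C : structure (LG G), is_model (T_G G) C /\
    exists e : V -> C, sat phi e /\ sat psi e.
Proof.
move=> mA mB pq satp satq.
have [C [mC [h [k [hh hk hpkq]]]]] := amalgamation mA mB pq.
exists C; split=> //; exists (h \o p); split; first exact: sat_hom.
by rewrite hpkq; exact: sat_hom.
Qed.

(** * Ultrapowers *)

Section Ultrapower.
Local Open Scope classical_set_scope.
Context (G : groupType) (A : structure (LG G)) (mA : is_model (T_G G) A).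
Context (I : Type) (U : set_system I) (UU : UltraFilter U).

Definition ultra_le (x y : I -> A) : Prop := U [set i | ole (x i) (y i)].

Lemma ultraT (P : set I) : (forall i, P i) -> U P.
Proof. by move=> PT; apply: filterS filterT => i _. Qed.

Lemma ultra_not (P : set I) : U (~` P) <-> ~ U P.
Proof.
split=> [UnP UP|nUP]; last by case: (in_ultra_setVsetC P UU).
by apply: (@filter_not_empty _ U _); rewrite -(setICr P); exact: filterI.
Qed.

Lemma ultra_le_total x y : ultra_le x y \/ ultra_le y x.
Proof.
case: (pselect (ultra_le x y)) => [|nxy]; first by left.
right; rewrite /ultra_le; apply: filterS ((ultra_not _).2 nxy) => i /= {}nxy.
by case: (ole_total mA (x i) (y i)).
Qed.

Lemma ultra_le_trans x y z : ultra_le x y -> ultra_le y z -> ultra_le x z.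
Proof.
rewrite /ultra_le => xy yz; apply: filterS (filterI xy yz) => i [].
exact: ole_trans.
Qed.

Definition ultra_act (g : G) (x : I -> A) : I -> A := fun i => act g (x i).

Lemma ultra_act1 x : ultra_act 1%g x = x.
Proof. by apply/funext => i; rewrite /ultra_act act1m. Qed.

Lemma ultra_actM g h x : ultra_act (g * h)%g x = ultra_act g (ultra_act h x).
Proof. by apply/funext => i; rewrite /ultra_act actMm. Qed.

Lemma ultra_act_mono g x y :
  ultra_le x y -> ultra_le (ultra_act g x) (ultra_act g y).
Proof.
by rewrite /ultra_le; apply: filterS => i /=; rewrite /ultra_act ole_act.
Qed.

Definition ultra_preorder : preorder_action G (I -> A) :=
  PreorderAction ultra_le_total ultra_le_trans ultra_act1 ultra_actM
    ultra_act_mono.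

Context (a0 : A).

Definition ultrapower : structure (LG G) := quot (fun=> a0) ultra_preorder.

Definition to_ultra (x : I -> A) : ultrapower :=
  to_quot (fun=> a0) ultra_preorder x.

Lemma olt_ultra x y :
  olt (to_ultra x) (to_ultra y) <-> U [set i | olt (x i) (y i)].
Proof.
rewrite olt_quot /= /ultra_le -ultra_not.
split; apply: filterS => i /=; first exact: contrapT.
by move=> xy; apply.
Qed.

Lemma act_ultra g x : act g (to_ultra x) = to_ultra (fun i => act g (x i)).
Proof. exact: act_quot. Qed.

Lemma eval_ultra (V : Type) (e : V -> I -> A) (t : term (LG G) V) :
  eval (fun v => to_ultra (e v)) t = to_ultra (fun i => eval (e^~ i) t).
Proof.
elim: t => [//|g ts IH] /=.
transitivity (act g (to_ultra (fun i => eval (e^~ i) (ts ord0)))).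
  by rewrite IH.
rewrite act_ultra; congr to_ultra; apply/funext => i.
by congr (fint A g _); apply/funext => j; rewrite ord1.
Qed.

(** The positive half of the theorem of Los.  A disjunction true almost
    everywhere has a disjunct true almost everywhere because [U] is an
    ultrafilter; an existential witness is chosen coordinatewise. *)
Lemma sat_ultra (V : Type) (p : pform (LG G) V) (e : V -> I -> A) :
  U [set i | sat p (e^~ i)] -> sat p (fun v => to_ultra (e v)).
Proof.
elim: p e => {V} [V|V|V t u|V [] ts|V p IHp q IHq|V p IHp q IHq|V p IH] e H.
- by [].
- by apply: (@filter_not_empty _ U _); apply: filterS H.
- rewrite /= !eval_ultra; apply: to_quot_eq;
    by apply: filterS H => i /= ->; exact: ole_refl.
- have eqlt : PRel _ ts = plt (ts ord0) (ts ord_max).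
    by rewrite /plt -pair2_eta.
  rewrite eqlt in H *; apply/sat_plt; rewrite !eval_ultra; apply/olt_ultra.
  by apply: filterS H => i /sat_plt.
- by split; [apply: IHp|apply: IHq]; apply: filterS H => i [].
- case: (in_ultra_setVsetC [set i | sat p (e^~ i)] UU).
    by left; exact: IHp.
  move=> np; right; apply: IHq; apply: filterS (filterI H np).
  by move=> i [[]].
- (* [a0] is a dummy witness at the coordinates where none exists. *)
  have wP i : {a | (exists b, sat p (fun v => oapp (e^~ i) b v)) ->
                   sat p (fun v => oapp (e^~ i) a v)}.
    apply: cid; case: (pselect (exists b, sat p (fun v => oapp (e^~ i) b v))).
      by case=> b pb; exists b.
    by move=> nb; exists a0.
  pose w i := sval (wP i); exists (to_ultra w).
  have := IH (fun v i => oapp (e^~ i) (w i) v).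
  set e1 := (fun v => to_ultra _); set e2 := (fun v => oapp _ _ _).
  have -> : e1 = e2 by apply/funext; case.
  by apply; apply: filterS H => i; exact: (svalP (wP i)).
Qed.

Lemma ultra_same_type (V : Type) (p q : V -> I -> A) :
  (forall g v w, U [set i | olt (p v i) (act g (p w i)) <->
                            olt (q v i) (act g (q w i))]) ->
  same_type (fun v => to_ultra (p v)) (fun v => to_ultra (q v)).
Proof.
move=> H g v w; rewrite !act_ultra !olt_ultra.
by split=> H'; apply: filterS (filterI H' (H g v w)) => i [/= + []]; tauto.
Qed.

End Ultrapower.

(** * Subsequences stabilising finitely many properties *)

Definition increasing_seq (f : nat -> nat) : Prop :=
  forall i j, i < j -> f i < f j.

Lemma increasing_comp f h :
  increasing_seq f -> increasing_seq h -> increasing_seq (f \o h).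
Proof. by move=> fi hi i j ij; apply: fi; apply: hi. Qed.

Lemma increasing_ge f : increasing_seq f -> forall n, n <= f n.
Proof. by move=> fi; elim=> // n IH; apply: leq_ltn_trans IH (fi _ _ _). Qed.

Lemma increasing_inj f : increasing_seq f -> injective f.
Proof.
move=> fi i j fij; case: (ltngtP i j) => // /fi; by rewrite fij ltnn.
Qed.

Lemma increasing_iterate (R : nat -> nat -> Prop) (n0 : nat) :
  (forall n, exists2 m, n < m & R n m) ->
  exists2 h, increasing_seq h & h 0 = n0 /\ forall k, R (h k) (h k.+1).
Proof.
move=> Rex; have nextP n : {m | n < m /\ R n m}.
  by apply: cid; case: (Rex n) => m; exists m.
pose h k := iter k (fun n => sval (nextP n)) n0.
exists h; last by split=> // k; case: (svalP (nextP (h k))).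
apply: (@homo_ltn _ h (fun i j => i < j)) => [j i k|k]; first exact: ltn_trans.
by case: (svalP (nextP (h k))).
Qed.

(** Properties of this kind can be imposed one after the other on a single
    subsequence, since the later refinements preserve the earlier ones. *)
Definition hereditarily_dense (Q : (nat -> nat) -> Prop) : Prop :=
  (forall f h, Q f -> increasing_seq h -> Q (f \o h)) /\
  (forall f, increasing_seq f -> exists2 h, increasing_seq h & Q (f \o h)).

Lemma dense_all (J : eqType) (Q : J -> (nat -> nat) -> Prop) (s : seq J) :
  (forall j, hereditarily_dense (Q j)) ->
  hereditarily_dense (fun f => forall j, j \in s -> Q j f).
Proof.
move=> QD; split=> [f h Qf hi j js|].
  by case: (QD j) => her _; apply: her (Qf j js) hi.
elim: s => [|j s IH] f fi; first by exists id.
have [h hi Qh] := IH f fi; have [her dense] := QD j.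
have [k ki Qk] := dense _ (increasing_comp fi hi).
exists (h \o k); first exact: increasing_comp.
move=> l; rewrite inE => /orP[/eqP->//|ls].
by case: (QD l) => herl _; exact: (herl _ _ (Qh l ls) ki).
Qed.

Definition eventually_constant (P : nat -> Prop) : Prop :=
  exists N, forall n m, N <= n -> N <= m -> (P n <-> P m).

Lemma eventually_constant_comp P h :
  eventually_constant P -> increasing_seq h -> eventually_constant (P \o h).
Proof.
move=> [N PN] hi; exists N => n m Nn Nm.
by apply: PN; [apply: leq_trans Nn _|apply: leq_trans Nm _]; exact: increasing_ge.
Qed.

Lemma eventually_constant_not P :
  eventually_constant (fun n => ~ P n) -> eventually_constant P.
Proof.
move=> [N PN]; exists N => n m Nn Nm; have := PN n m Nn Nm.
by case: (pselect (P n)); case: (pselect (P m)); tauto.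
Qed.

Lemma eventually_constant_upward P :
  (forall i j, i <= j -> P i -> P j) -> eventually_constant P.
Proof.
move=> up; case: (pselect (exists i, P i)) => [[i Pi]|nP].
  by exists i => n m /up/(_ Pi) Pn /up/(_ Pi) Pm.
by exists 0 => n m _ _; split=> H; case: nP; eexists; exact: H.
Qed.

Lemma eventually_constant_dense (P : nat -> Prop) :
  hereditarily_dense (fun f => eventually_constant (P \o f)).
Proof.
split=> [f h|f fi]; first exact: eventually_constant_comp.
case: (pselect (exists N, forall n, N <= n -> ~ P (f n))) => [[N nP]|inf].
  exists id => //; exists N => n m Nn Nm.
  by split=> H; [case: (nP n Nn)|case: (nP m Nm)].
have [|h hi [_ Ph]] := @increasing_iterate (fun _ m => P (f m)) 0.
  move=> n; apply: contrapT => nex; apply: inf; exists n.+1 => m nm Pm.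
  by apply: nex; exists m.
apply: (ex_intro2 _ _ h hi); exists 1 => -[//|n] [//|m] _ _.
by split=> _; exact: Ph.
Qed.

(** * Monotone subsequences and cuts *)

Section Cuts.
Context (G : groupType) (A : structure (LG G)) (mA : is_model (T_G G) A).

Definition cuts_converge (u : nat -> A) : Prop := forall t,
  eventually_constant (fun n => olt (u n) t) /\
  eventually_constant (fun n => olt t (u n)).

Lemma nondecreasing_cuts u :
  (forall i j, i <= j -> ole (u i) (u j)) -> cuts_converge u.
Proof.
move=> ui t; split.
  apply: eventually_constant_not; apply: eventually_constant_upward => i j ij tu.
  exact: (ole_trans mA tu (ui i j ij)).
apply: eventually_constant_upward => i j ij tu; apply: contrapT => ut.
exact: (ole_trans mA (ui i j ij) ut).
Qed.

Lemma nonincreasing_cuts u :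
  (forall i j, i <= j -> ole (u j) (u i)) -> cuts_converge u.
Proof.
move=> ui t; split.
  apply: eventually_constant_upward => i j ij tu; apply: contrapT => ut.
  exact: (ole_trans mA ut (ui i j ij)).
apply: eventually_constant_not; apply: eventually_constant_upward => i j ij tu.
exact: (ole_trans mA (ui i j ij) tu).
Qed.

(** A peak is an index whose value is an upper bound for all later ones.
    Either there are infinitely many peaks, which form a nonincreasing
    subsequence, or beyond some index every term is followed by a
    term at least as large. *)
Lemma monotone_subsequence (u : nat -> A) : exists2 h, increasing_seq h &
  (forall i j, i <= j -> ole (u (h i)) (u (h j))) \/
  (forall i j, i <= j -> ole (u (h j)) (u (h i))).
Proof.
pose peak n := forall m, n < m -> ole (u m) (u n).
case: (pselect (exists N, forall n, N <= n -> ~ peak n)) => [[N npeak]|inf].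
  have [|h hi [h0 hle]] := @increasing_iterate
      (fun n m => N <= n -> ole (u n) (u m)) N.
    move=> n; case: (leqP N n) => [Nn|nN]; last by exists n.+1.
    apply: contrapT => nex; apply: (npeak n Nn) => m nm.
    by case: (ole_total mA (u m) (u n)) => // unm; case: nex; exists m.
  exists h => //; left; apply: (@homo_leq _ (u \o h) (@ole G A)) => [a|b a c|k].
  - exact: ole_refl.
  - exact: ole_trans.
  - by apply: hle; rewrite -h0; case: k => // k; rewrite ltnW ?hi.
have peakex n : exists2 m, n < m & peak m.
  apply: contrapT => nex; apply: inf; exists n.+1 => m nm mp.
  by apply: nex; exists m.
have [n0 _ n0p] := peakex 0.
have [|h hi [h0 hp]] := @increasing_iterate (fun _ m => peak m) n0.
  by move=> n; case: (peakex n) => m; exists m.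
exists h => //; right=> i j; rewrite leq_eqVlt => /orP[/eqP->|ij].
  exact: ole_refl.
by have: peak (h i) by [case: (i) => [|k]; [rewrite h0|exact: hp]]; apply; exact: hi.
Qed.

Lemma cuts_converge_dense (u : nat -> A) :
  hereditarily_dense (fun f => cuts_converge (u \o f)).
Proof.
split=> [f h uf hi t|f fi].
  by case: (uf t) => ut tu; split; [move: ut|move: tu];
    move/eventually_constant_comp; apply.
have [h hi [up|down]] := monotone_subsequence (u \o f);
  apply: (ex_intro2 _ _ h hi); first exact: nondecreasing_cuts.
exact: nonincreasing_cuts.
Qed.

End Cuts.

(** * The index filter *)

Section Tails.
Local Open Scope classical_set_scope.
Context (J : eqType).

(** The bound [N] may depend on [s], because the subsequence attached to [s],
    and the speed at which atoms stabilise along it, do. *)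
Definition tail_filter : set_system (seq J * nat) := fun P =>
  exists s0 : seq J, forall s, (forall j, j \in s0 -> j \in s) ->
  exists N, forall n, N <= n -> P (s, n).

Lemma tail_filter_proper : ProperFilter tail_filter.
Proof.
split; first by case=> s /(_ s (fun _ => id)) [N /(_ N (leqnn N))].
split; first by exists [::] => s _; exists 0.
- move=> P Q [s0 P0] [s1 Q1]; exists (s0 ++ s1) => s ss.
  have [|N PN] := P0 s; first by move=> j js; rewrite ss // mem_cat js.
  have [|M QM] := Q1 s; first by move=> j js; rewrite ss // mem_cat js orbT.
  exists (maxn N M) => n; rewrite geq_max => /andP[Nn Mn].
  by split; [exact: PN|exact: QM].
- move=> P Q PQ [s0 P0]; exists s0 => s /P0 [N PN]; exists N => n /PN.
  exact: PQ.
Qed.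

End Tails.

(** * Extraction of two tuples of the same type *)

Section Alternation.
Local Open Scope classical_set_scope.
Context (G : groupType) (A : structure (LG G)) (mA : is_model (T_G G) A).
Context (m : nat) (a : nat -> 'I_m -> A).

(** Cuts are handled for all points at once, whereas the atoms [x_k < g x_l],
    on which monotonicity of the two coordinates gives no control, are handled
    for the finite list [s] only. *)
Lemma stabilizing_subsequence (s : seq ('I_m * G * 'I_m)) :
  exists f, [/\ increasing_seq f,
    forall k, cuts_converge (fun n => a (f n) k) &
    forall k g l, (k, g, l) \in s ->
      eventually_constant (fun n => olt (a (f n) k) (act g (a (f n) l)))].
Proof.
have [_ /(_ id (fun _ _ => id)) [f fi cf]] := dense_all (enum 'I_m)
  (fun k => cuts_converge_dense mA (a^~ k)).
have [_ /(_ f fi) [h hi ch]] := dense_all s (fun t : 'I_m * G * 'I_m =>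
  eventually_constant_dense
    (fun n => olt (a n t.1.1) (act t.1.2 (a n t.2)))).
exists (f \o h); split=> [|k|k g l]; [exact: increasing_comp| |by move/ch].
by case: (cuts_converge_dense mA (a^~ k)) => her _; apply: her (cf k _) hi;
  rewrite mem_enum.
Qed.

End Alternation.

Lemma eventually_same_parity (P : nat -> Prop) : eventually_constant P ->
  exists N, forall n, N <= n -> (P n.*2 <-> P n.*2.+1).
Proof.
move=> [N PN]; exists N => n Nn; have Nn2 : N <= n.*2.
  by rewrite -addnn (leq_trans Nn) ?leq_addr.
by apply: PN => //; exact: leqW.
Qed.

Theorem proposition6p37 (G : groupType) : NIP (T_G G).
Proof.
move=> m n phi [psi [incons [A [mA [a [b ab]]]]]].
pose J := ('I_m * G * 'I_m)%type.
have [f fP] := choice (stabilizing_subsequence mA a : forall s : seq J, _).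
have [U [UU tailU]] := ultraFilterLemma (tail_filter_proper J).
have [a0] := carrier_inh A.
pose W s : set nat := fun i => exists k, i = f s k.*2.
pose point (j : nat -> nat) (v : 'I_m + 'I_n) (x : seq J * nat) : A :=
  match v with inl k => a (f x.1 (j x.2)) k | inr l => b (W x.1) l end.
(* [double] gives the even terms of the subsequence, on which [phi] holds,
   and its successor the odd ones, on which [psi] holds. *)
have satU (theta : pform (LG G) ('I_m + 'I_n)) j :
    (forall x, sat2 theta (a (f x.1 (j x.2))) (b (W x.1))) ->
    sat theta (fun v => to_ultra mA UU a0 (point j v)).
  move=> H; apply: sat_ultra; apply: ultraT => x /=.
  by apply/sat2E; exact: H.
have satp := satU phi double (fun x => proj1 (ab _ _) (ex_intro _ x.2 erefl)).
have satq : sat psi (fun v => to_ultra mA UU a0 (point (fun k => k.*2.+1) v)).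
  apply: satU => -[s k] /=; apply: (proj2 (ab _ _)) => -[k' ekk'].
  have [fi _ _] := fP s; move/(increasing_inj fi)/(congr1 odd): ekk'.
  by rewrite /= !odd_double.
have : same_type (fun v => to_ultra mA UU a0 (point double v))
                 (fun v => to_ultra mA UU a0 (point (fun k => k.*2.+1) v)).
  apply: ultra_same_type => g [k|k] [l|l]; apply: tailU.
  - exists [:: (k, g, l)] => s /(_ _ (mem_head _ _)) ks.
    by have [_ _ /(_ k g l ks) /eventually_same_parity] := fP s.
  - exists [::] => s _; have [_ cf _] := fP s.
    by have [/eventually_same_parity] := cf k (act g (b (W s) l)).
  - exists [::] => s _; have [_ cf _] := fP s.
    have [_ /eventually_same_parity [N sN]] := cf l (act g^-1%g (b (W s) k)).
    by exists N => i /sN /=; rewrite !(olt_actr mA).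
  - by exists [::] => s _; exists 0.
move=> /same_type_consistent/(_ satp satq) []; try exact: quot_model.
move=> C [mC [e [ephi epsi]]].
by apply: (incons C mC (e \o inl) (e \o inr)); rewrite !sat2E.
Qed.
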